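(* Let $\kappa=\kappa(\rho)$ be a function such that $\rho\,\kappa(\rho)$ is continuous. Then the problem of determining locally a spacelike or timelike curve in $\mathbb{L}^2$ whose curvature is $\kappa(\rho)$ with geometric angular momentum $\mathcal K(\rho)$ satisfying $d\mathcal K=\rho\,\kappa(\rho)\,d\rho$ (where $\rho$ is the (non constant) Lorentzian pseudodistance from the origin) is solvable by quadratures considering the unit-speed curve $\gamma$ in pseudopolar coordinates given by $$\gamma^+_\epsilon(s)=(\pm\rho^+_\epsilon(s)\sinh\nu^+_\epsilon(s),\ \pm\rho^+_\epsilon(s)\cosh\nu^+_\epsilon(s)),$$ $$\gamma^-_\epsilon(s)=(\pm\rho^-_\epsilon(s)\cosh\nu^-_\epsilon(s),\ \pm\rho^-_\epsilon(s)\sinh\nu^-_\epsilon(s)),$$ where $\epsilon=1$ in the spacelike case and $\epsilon=-1$ in the timelike case; $\rho^+_\epsilon(s)$ and $\nu^+_\epsilon(s)$ are obtained through $$ds=\frac{\rho\,d\rho}{\sqrt{\mathcal K^2+\epsilon\rho^2}},\qquad d\nu=\frac{\mathcal K\,ds}{\rho^2}$$ after inverting $s=s(\rho)$; and, respectively, $\rho^-_\epsilon(s)$ and $\nu^-_\epsilon(s)$ are obtained through $$ds=\frac{\rho\,d\rho}{\sqrt{\mathcal K^2-\epsilon\rho^2}},\qquad d\nu=\frac{\mathcal K\,ds}{\rho^2}$$ after inverting $s=s(\rho)$ (in each case with $\rho>0$ and positive radicand). Such a curve is uniquely determined by $\mathcal K(\rho)$ up to a $\nu$-orthochrone Lorentz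 transformation (and a translation of the arc parameter $s$).
   Context: $\mathbb{L}^2=(\mathbb{R}^2,g=-dx^2+dy^2)$ is the Lorentz-Minkowski plane with rectangular coordinates $(x,y)$. A curve $\gamma=(x,y)$ is spacelike (resp. timelike) if $g(\gamma',\gamma')>0$ (resp. $<0$) everywhere. It is unit-speed if $g(\dot\gamma,\dot\gamma)=\epsilon$ with $\epsilon=1$ (spacelike) or $\epsilon=-1$ (timelike); the dot is the derivative with respect to the arc parameter $s$. For a unit-speed curve put $T=\dot\gamma=(\dot x,\dot y)$ and $N=(\dot y,\dot x)$; the (signed) curvature $\kappa$ is defined by $\dot T=\kappa N$, i.e. $\kappa=\epsilon(\ddot x\dot y-\dot x\ddot y)$. The Lorentzian pseudodistance from the origin is $\rho=\sqrt{|g(\gamma,\gamma)|}=\sqrt{|-x^2+y^2|}\ge 0$. Pseudopolar coordinates $(\rho,\nu)$, with $\nu\in\mathbb{R}$ the orthochrone angle, are given by $(x,y)=\pm(\rho\sinh\nu,\rho\cosh\nu)$ where $-x^2+y^2\ge 0$ and by $(x,y)=\pm(\rho\cosh\nu,\rho\sinh\nu)$ where $-x^2+y^2\le 0$. The geometric angular momentum of a unit-speed curve written in these coordinates is $\mathcal K(s)=\rho(s)^2\,\dot\nu(s)$. For $\nu\in\mathbb{R}$, the $\nu$-orthochrone Lorentz transformation is $R_\nu(x,y)=(\cosh\nu\,x+\sinh\nu\,y,\ \sinh\nu\,x+\cosh\nu\,y)$. *)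

(* Defs.v *)
From Stdlib Require Import Reals.
From Coquelicot Require Import Coquelicot.

Local Open Scope R_scope.

Definition in_oo (a b : Rbar) (t : R) : Prop := Rbar_lt a t /\ Rbar_lt t b.

Definition is_sign (e : R) : Prop := e = 1 \/ e = -1.

Definition lorentz (u v : R * R) : R := - (fst u * fst v) + snd u * snd v.

Definition pseudodist (p : R * R) : R := sqrt (Rabs (lorentz p p)).

Definition tangent (gamma : R -> R * R) (s : R) : R * R :=
  (Derive (fun t => fst (gamma t)) s, Derive (fun t => snd (gamma t)) s).

Definition normal (gamma : R -> R * R) (s : R) : R * R :=
  (snd (tangent gamma s), fst (tangent gamma s)).

(* [eps = 1]: spacelike; [eps = -1]: timelike. *)
Definition unit_speed_at (eps : R) (gamma : R -> R * R) (s : R) : Prop :=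
  ex_derive (fun t => fst (gamma t)) s /\
  ex_derive (fun t => snd (gamma t)) s /\
  lorentz (tangent gamma s) (tangent gamma s) = eps.

(* The Frenet equation T' = k N; in particular T is differentiable at s. *)
Definition curvature_at (gamma : R -> R * R) (s k : R) : Prop :=
  is_derive (fun t => fst (tangent gamma t)) s (k * fst (normal gamma s)) /\
  is_derive (fun t => snd (tangent gamma t)) s (k * snd (normal gamma s)).

(* The regions - x^2 + y^2 >= 0 ([RPlus]) and - x^2 + y^2 <= 0 ([RMinus]). *)
Inductive region : Set := RPlus | RMinus.

(* [sg] is the common sign +/- of both coordinates. *)
Definition pseudopolar (reg : region) (sg rho nu : R) : R * R :=
  match reg with
  | RPlus => (sg * rho * sinh nu, sg * rho * cosh nu)
  | RMinus => (sg * rho * cosh nu, sg * rho * sinh nu)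
  end.

Definition ang_momentum (rho nu : R -> R) (s : R) : R :=
  (rho s) ^ 2 * Derive nu s.

Definition boost (v : R) (p : R * R) : R * R :=
  (cosh v * fst p + sinh v * snd p, sinh v * fst p + cosh v * snd p).

(* On the parameter interval (sa, sb), gamma is a unit-speed curve of causal
   character eps, with pseudopolar coordinates (rho, nu) on the branch
   (reg, sg) and rho in (a, b), whose curvature is kappa(rho) and whose
   geometric angular momentum is K(rho). *)
Definition solution (reg : region) (sg eps : R) (kappa K : R -> R)
    (a b sa sb : Rbar) (gamma : R -> R * R) (nu : R -> R) : Prop :=
  let rho := fun t => pseudodist (gamma t) in
  forall s, in_oo sa sb s ->
    in_oo a b (rho s) /\
    gamma s = pseudopolar reg sg (rho s) (nu s) /\
    ex_derive nu s /\
    unit_speed_at eps gamma s /\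
    curvature_at gamma s (kappa (rho s)) /\
    ang_momentum rho nu s = K (rho s).

Definition radicand (reg : region) (eps : R) (K : R -> R) (r : R) : R :=
  match reg with
  | RPlus => (K r) ^ 2 + eps * r ^ 2
  | RMinus => (K r) ^ 2 - eps * r ^ 2
  end.

(* s(rho), from ds = o rho drho / sqrt(radicand) and s(r0) = s0.  The sign o
   is the orientation of the arc parameter: o = 1 when rho increases along the
   curve, o = -1 when rho decreases. *)
Definition arc_param (reg : region) (eps o : R) (K : R -> R)
    (r0 s0 r : R) : R :=
  s0 + o * RInt (fun t => t / sqrt (radicand reg eps K t)) r0 r.

(* nu(s), from dnu = K(rho) ds / rho^2 and nu(s0) = nu0. *)
Definition angle (K rho : R -> R) (s0 nu0 s : R) : R :=
  nu0 + RInt (fun u => K (rho u) / (rho u) ^ 2) s0 s.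

(* [f] maps (a, b) bijectively onto (c, d), with inverse [g]. *)
Definition inverse_on (a b c d : Rbar) (f g : R -> R) : Prop :=
  (forall r, in_oo a b r -> in_oo c d (f r) /\ g (f r) = r) /\
  (forall s, in_oo c d s -> in_oo a b (g s) /\ f (g s) = s).

Definition quadrature (reg : region) (eps o : R) (K : R -> R)
    (a b : Rbar) (r0 s0 nu0 : R) (sa sb : Rbar) (rho nu : R -> R) : Prop :=
  inverse_on a b sa sb (arc_param reg eps o K r0 s0) rho /\
  (forall s, in_oo sa sb s -> nu s = angle K rho s0 nu0 s).

(* Main.v *)
(* In the moving frame of directions of increasing rho and nu, a curve
   (rho, nu) has velocity (rho', rho nu'), and differentiating frame components
   (p, q) gives (p' + q nu', q' + p nu'), in both regions.  With
   K = rho^2 nu', unit speed therefore amounts to (rho rho')^2 = radicand, and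
   differentiating rho' = o sqrt(radicand) / rho and nu' = K / rho^2 with
   dK = rho kappa drho gives T' = kappa N.  Conversely, rho rho' is continuous
   without zeros on any solution, so it has a constant sign o; then the arc
   length quadrature composed with rho has derivative 1 and is a translation,
   and theta and nu have the same derivative, so they differ by a boost angle. *)

Require Import Defs.
From Stdlib Require Import Reals Lra Classical ClassicalEpsilon Ranalysis5.
From Coquelicot Require Import Coquelicot.
Local Open Scope R_scope.

(** * Calculus on open intervals with extended real ends *)

Lemma in_oo_pos (a b : Rbar) (r : R) :
  Rbar_le (Finite 0) a -> in_oo a b r -> 0 < r.
Proof. intros Ha [Hr _]. exact (Rbar_le_lt_trans (Finite 0) a (Finite r) Ha Hr). Qed.

Lemma in_oo_between (a b : Rbar) (x y z : R) :
  in_oo a b x -> in_oo a b y -> x <= z <= y -> in_oo a b z.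
Proof.
  intros [ax _] [_ yb] [Hl Hr]; split.
  - now apply Rbar_lt_le_trans with (Finite x).
  - now apply Rbar_le_lt_trans with (Finite y).
Qed.

Lemma in_oo_segment (a b : Rbar) (x y z : R) :
  in_oo a b x -> in_oo a b y -> Rmin x y <= z <= Rmax x y -> in_oo a b z.
Proof.
  intros Hx Hy. unfold Rmin, Rmax. destruct (Rle_dec x y); intros Hz.
  - now apply (in_oo_between a b x y).
  - now apply (in_oo_between a b y x).
Qed.

Lemma in_oo_locally (a b : Rbar) (x : R) :
  in_oo a b x -> locally x (fun t => in_oo a b t).
Proof.
  intros [ax xb]. apply (locally_interval _ x a b ax xb).
  intros y ay yb; split; assumption.
Qed.

Lemma in_oo_ball (a b : Rbar) (x e : R) :
  in_oo a b x -> 0 < e ->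
  exists d, 0 < d <= e /\ in_oo a b (x - d) /\ in_oo a b (x + d).
Proof.
  intros Hx He. destruct (in_oo_locally a b x Hx) as [d Hd].
  assert (Hd0 := cond_pos d).
  assert (Hm : 0 < Rmin e (d / 2)) by (apply Rmin_glb_lt; lra).
  exists (Rmin e (d / 2)). assert (Hm2 := Rmin_r e (d / 2)).
  split; [split; [exact Hm | apply Rmin_l]|].
  split; apply Hd; apply Rabs_def1; unfold minus, plus, opp; simpl; lra.
Qed.

Lemma is_derive_zero_const (a b : Rbar) (f : R -> R) (x y : R) :
  (forall t, in_oo a b t -> is_derive f t 0) ->
  in_oo a b x -> in_oo a b y -> f x = f y.
Proof.
  intros Hf Hx Hy.
  assert (Hxy : forall t, Rmin x y <= t <= Rmax x y -> is_derive f t 0).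
  { intros t Ht. apply Hf. now apply (in_oo_segment a b x y). }
  destruct (MVT_gen f x y (fun _ => 0)) as [c [_ Hc]].
  - intros t Ht. apply Hxy. lra.
  - intros t Ht. apply continuity_pt_filterlim, (ex_derive_continuous f t).
    exists 0. now apply Hxy.
  - lra.
Qed.

Lemma is_derive_RInt_oo (a b : Rbar) (h : R -> R) (x0 x : R) :
  (forall t, in_oo a b t -> continuous h t) ->
  in_oo a b x0 -> in_oo a b x -> is_derive (RInt h x0) x (h x).
Proof.
  intros Hh Hx0 Hx. apply (is_derive_RInt h (RInt h x0) x0 x); [|now apply Hh].
  apply filter_imp with (2 := in_oo_locally a b x Hx). intros y Hy.
  apply (RInt_correct h), ex_RInt_continuous. intros z Hz.
  apply Hh. now apply (in_oo_segment a b x0 y).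
Qed.

(** The points [x] and [y] come in either order, so that decreasing functions are covered: for
    [y < x] the classical theorem is applied to [z - f] instead of [f - z]. *)
Lemma IVT_oo (a b : Rbar) (f : R -> R) (x y z : R) :
  (forall t, in_oo a b t -> continuous f t) ->
  in_oo a b x -> in_oo a b y -> f x < z < f y ->
  exists t, in_oo a b t /\ f t = z.
Proof.
  intros Hf Hx Hy Hz.
  assert (Cf : forall t, in_oo a b t -> continuity_pt f t).
  { intros t Ht. now apply continuity_pt_filterlim, Hf. }
  assert (Cz : forall t, continuity_pt (fun _ : R => z) t).
  { intros t. now apply continuity_pt_const. }
  destruct (Rtotal_order x y) as [Hxy | [-> | Hxy]].
  - destruct (IVT_interv (fun t => f t - z) x y) as [t [Ht Et]]; try lra.
    + intros t Ht. apply (continuity_pt_minus f (fun _ => z)); [|easy].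
      now apply Cf, (in_oo_between a b x y).
    + exists t; split; [now apply (in_oo_between a b x y) | lra].
  - lra.
  - destruct (IVT_interv (fun t => z - f t) y x) as [t [Ht Et]]; try lra.
    + intros t Ht. apply (continuity_pt_minus (fun _ => z) f); [easy|].
      now apply Cf, (in_oo_between a b y x).
    + exists t; split; [now apply (in_oo_between a b y x) | lra].
Qed.

(** Values of both signs would force a zero in between. So one negative value makes [f] negative
    everywhere, and otherwise [f] is positive everywhere. *)
Lemma constant_sign (a b : Rbar) (f : R -> R) :
  (forall t, in_oo a b t -> continuous f t) ->
  (forall t, in_oo a b t -> f t <> 0) ->
  exists o, is_sign o /\ forall t, in_oo a b t -> 0 < o * f t.
Proof.
  intros Cf Hf.
  destruct (classic (exists x, in_oo a b x /\ f x < 0)) as [[x [Hx Fx]] | Hn].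
  - exists (-1). split; [now right|]. intros t Ht.
    destruct (Rlt_le_dec (f t) 0) as [|H]; [lra|].
    assert (H0 := Hf t Ht).
    destruct (IVT_oo a b f x t 0 Cf Hx Ht) as [u [Hu Eu]]; [lra|].
    now elim (Hf u Hu).
  - exists 1. split; [now left|]. intros t Ht.
    destruct (Rlt_le_dec (f t) 0) as [H|H].
    + elim Hn. now exists t.
    + assert (H0 := Hf t Ht). lra.
Qed.

Lemma increasing_oo (a b : Rbar) (f df : R -> R) (x y : R) :
  (forall t, in_oo a b t -> is_derive f t (df t)) ->
  (forall t, in_oo a b t -> 0 < df t) ->
  in_oo a b x -> in_oo a b y -> x < y -> f x < f y.
Proof.
  intros Hf Hdf Hx Hy Hxy.
  assert (Hseg : forall t, Rmin x y <= t <= Rmax x y -> in_oo a b t).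
  { intros t Ht. now apply (in_oo_segment a b x y). }
  destruct (MVT_gen f x y df) as [c [Hc Ec]].
  - intros t Ht. apply Hf, Hseg. lra.
  - intros t Ht. apply continuity_pt_filterlim, (ex_derive_continuous f t).
    exists (df t). now apply Hf, Hseg.
  - assert (Hdc := Hdf c (Hseg c Hc)).
    assert (0 < df c * (y - x)) by (apply Rmult_lt_0_compat; lra). lra.
Qed.

(** * Inverses of strictly monotone functions *)

(** With [k = g (s + h) - g s], the quotient [k / h] is the reciprocal of the difference quotient of
    [f] at [g s] for the increment [k]. Continuity of [g] makes [k] small, and inversion is
    continuous at [l], which is nonzero. *)
Lemma is_derive_inverse (f g : R -> R) (s l : R) :
  is_derive f (g s) l -> l <> 0 -> continuous g s ->
  locally s (fun t => f (g t) = t) -> is_derive g s (/ l).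
Proof.
  intros Hf Hl Cg Hfg. apply is_derive_Reals in Hf. apply is_derive_Reals.
  assert (Es : f (g s) = s) by (apply locally_singleton with (1 := Hfg)).
  intros e He.
  assert (Ci : continuity_pt Rinv l).
  { apply (continuity_pt_inv id); [apply continuity_pt_id | exact Hl]. }
  apply continuity_pt_filterlim in Ci.
  destruct (proj1 (filterlim_locally Rinv (/ l)) Ci (mkposreal e He)) as [e' He'].
  destruct (Hf e' (cond_pos e')) as [d Hd].
  destruct (filter_and _ _ (proj1 (filterlim_locally g (g s)) Cg d) Hfg) as [d' Hd'].
  exists d'. intros h Hh Hhd.
  destruct (Hd' (s + h)) as [Hk Ek].
  { red; simpl; red. unfold minus, plus, opp, abs; simpl.
    now replace (s + h + - s) with h by ring. }
  change (Rabs (g (s + h) - g s) < d) in Hk.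
  set (k := g (s + h) - g s) in *.
  assert (Egk : g (s + h) = g s + k) by (unfold k; ring).
  (* If [k] vanished, applying [f] to [g (s + h) = g s] would give [s + h = s]. *)
  assert (Hk0 : k <> 0).
  { intros E. rewrite E, Rplus_0_r in Egk. rewrite Egk in Ek. lra. }
  specialize (Hd k Hk0 Hk). rewrite <- Egk, Ek, Es in Hd.
  replace (s + h - s) with h in Hd by ring.
  specialize (He' (h / k) Hd). change (Rabs (/ (h / k) - / l) < e) in He'.
  replace (k / h) with (/ (h / k)) by (field; split; assumption).
  exact He'.
Qed.

(** Since [o * f] is strictly increasing, the inverse is continuous, which is what the pointwise
    rule for the derivative of an inverse asks for. The factor [o] treats increasing and decreasing
    [f] together. *)
Lemma inverse_on_is_derive (a b c d : Rbar) (f g df : R -> R) (o s : R) :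
  inverse_on a b c d f g ->
  (forall t, in_oo a b t -> is_derive f t (df t)) ->
  is_sign o -> (forall t, in_oo a b t -> 0 < o * df t) ->
  in_oo c d s -> is_derive g s (/ df (g s)).
Proof.
  intros [_ Hinv] Hf Ho Hdf Hs.
  destruct (Hinv s Hs) as [Hgs Efg].
  assert (Hmon : forall x y, in_oo a b x -> in_oo a b y -> x < y -> o * f x < o * f y).
  { intros x y. apply (increasing_oo a b (fun t => o * f t) (fun t => o * df t)).
    - intros t Ht. now apply (is_derive_scal f), Hf.
    - exact Hdf. }
  apply is_derive_inverse with f.
  - now apply Hf.
  - intros E. specialize (Hdf _ Hgs). rewrite E in Hdf. lra.
  - apply filterlim_locally. intros [e He].
    destruct (in_oo_ball a b (g s) e Hgs He) as [r [Hr [Hl Hu]]].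
    assert (H1 := Hmon _ _ Hl Hgs ltac:(lra)). assert (H2 := Hmon _ _ Hgs Hu ltac:(lra)).
    rewrite Efg in H1, H2.
    (* The values of [o * f] at [g s - r] and [g s + r] strictly enclose [o * s]. For [t] near [s]
       they still enclose [o * t], and monotonicity then keeps [g t] between [g s - r] and
       [g s + r]. *)
    assert (Hloc : locally s (fun t => o * f (g s - r) < o * t < o * f (g s + r))).
    { assert (Co : filterlim (fun t => o * t) (locally s) (locally (o * s))).
      { apply (filterlim_scal_r o s). }
      apply (Co (fun u => o * f (g s - r) < u < o * f (g s + r))).
      apply (locally_interval _ (o * s) (o * f (g s - r)) (o * f (g s + r)) H1 H2).
      now split. }
    apply filter_imp with (2 := filter_and _ _ Hloc (in_oo_locally c d s Hs)).
    intros t [Ht Hct]. destruct (Hinv t Hct) as [Hgt Egt].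
    apply Rabs_def1; unfold minus, plus, opp; simpl.
    + destruct (Rlt_le_dec (g t) (g s + r)) as [H|[H|H]]; [lra| |].
      * specialize (Hmon _ _ Hu Hgt H). rewrite Egt in Hmon. lra.
      * rewrite H, Egt in Ht. lra.
    + destruct (Rlt_le_dec (g s - r) (g t)) as [H|[H|H]]; [lra| |].
      * specialize (Hmon _ _ Hgt Hl H). rewrite Egt in Hmon. lra.
      * rewrite <- H, Egt in Ht. lra.
  - apply filter_imp with (2 := in_oo_locally c d s Hs). intros t Ht. now apply Hinv.
Qed.

(** By the intermediate value property the image of [f] is an interval. Its ends are the bounds of
    the image in the extended reals, and they are not attained because each point of the open domain
    has neighbours on both sides. The inverse picks a preimage by choice. *)
Lemma inverse_on_exists (a b : Rbar) (f df : R -> R) (o : R) :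
  (forall t, in_oo a b t -> is_derive f t (df t)) ->
  is_sign o -> (forall t, in_oo a b t -> 0 < o * df t) ->
  exists (c d : Rbar) (g : R -> R), inverse_on a b c d f g.
Proof.
  intros Hf Ho Hdf.
  assert (Hmon : forall x y, in_oo a b x -> in_oo a b y -> x < y -> o * f x < o * f y).
  { intros x y. apply (increasing_oo a b (fun t => o * f t) (fun t => o * df t)).
    - intros t Ht. now apply (is_derive_scal f), Hf.
    - exact Hdf. }
  set (E := fun s => exists r, in_oo a b r /\ f r = s).
  destruct (Glb_Rbar_correct E) as [Gl Gg]. destruct (Lub_Rbar_correct E) as [Ll Lg].
  set (c := Glb_Rbar E) in *. set (d := Lub_Rbar E) in *.
  set (g := fun s => epsilon (inhabits 0) (fun r => in_oo a b r /\ f r = s)).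
  assert (Hg : forall s, E s -> in_oo a b (g s) /\ f (g s) = s).
  { intros s Hs. apply (epsilon_spec (inhabits 0) (fun r => in_oo a b r /\ f r = s) Hs). }
  exists c, d, g. split.
  - intros r Hr. split.
    + destruct (in_oo_ball a b r 1 Hr Rlt_0_1) as [e [He [Hl Hu]]].
      assert (H1 := Hmon _ _ Hl Hr ltac:(lra)). assert (H2 := Hmon _ _ Hr Hu ltac:(lra)).
      assert (El : E (f (r - e))) by now exists (r - e).
      assert (Eu : E (f (r + e))) by now exists (r + e).
      (* For [o = -1] the smaller value of [f] is taken at the right neighbour [r + e]. *)
      destruct Ho as [-> | ->]; split.
      * apply Rbar_le_lt_trans with (f (r - e)); [now apply Gl | simpl; lra].
      * apply Rbar_lt_le_trans with (f (r + e)); [simpl; lra | now apply Ll].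
      * apply Rbar_le_lt_trans with (f (r + e)); [now apply Gl | simpl; lra].
      * apply Rbar_lt_le_trans with (f (r - e)); [simpl; lra | now apply Ll].
    + destruct (Hg (f r)) as [Hgr Egr]; [now exists r|].
      destruct (Rtotal_order (g (f r)) r) as [H | [H | H]]; [|exact H|].
      * specialize (Hmon _ _ Hgr Hr H). rewrite Egr in Hmon. lra.
      * specialize (Hmon _ _ Hr Hgr H). rewrite Egr in Hmon. lra.
  - intros s [Hcs Hsd]. apply Hg.
    (* Without such an [x], the number [s] would be a lower bound of the image, against [c < s]; the
       upper side is symmetric. *)
    assert (Hlow : exists x, in_oo a b x /\ f x < s).
    { apply NNPP. intros Hn. apply Rbar_lt_not_le in Hcs. apply Hcs, Gg.
      intros x [r [Hr <-]]. simpl. apply Rnot_lt_le. intros H. apply Hn. now exists r. }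
    assert (Hup : exists y, in_oo a b y /\ s < f y).
    { apply NNPP. intros Hn. apply Rbar_lt_not_le in Hsd. apply Hsd, Lg.
      intros x [r [Hr <-]]. simpl. apply Rnot_lt_le. intros H. apply Hn. now exists r. }
    destruct Hlow as [x [Hx Fx]]. destruct Hup as [y [Hy Fy]].
    apply (IVT_oo a b f x y s); try easy.
    intros t Ht. apply (ex_derive_continuous f). exists (df t). now apply Hf.
Qed.

(** * Hyperbolic functions and the pseudopolar frame *)

(** This is the sign of the Lorentz square of a position vector with [rho > 0]. It is also the sign
    before [eps * r ^ 2] in the radicand, so both regions can share one computation. *)
Definition region_sign (reg : region) : R :=
  match reg with RPlus => 1 | RMinus => -1 end.

(* Components [p] and [q] along the unit vectors in the directions of
   increasing [rho] and increasing [nu]. *)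
Definition polar_frame (reg : region) (p q nu : R) : R * R :=
  match reg with
  | RPlus => (p * sinh nu + q * cosh nu, p * cosh nu + q * sinh nu)
  | RMinus => (p * cosh nu + q * sinh nu, p * sinh nu + q * cosh nu)
  end.

Lemma is_sign_sqr (o : R) : is_sign o -> o * o = 1.
Proof. intros [-> | ->]; ring. Qed.

Lemma is_sign_region (reg : region) : is_sign (region_sign reg).
Proof. destruct reg; [now left | now right]. Qed.

Lemma cosh_sqr (x : R) : cosh x * cosh x = 1 + sinh x * sinh x.
Proof.
  assert (H := exp_plus x (- x)). rewrite Rplus_opp_r, exp_0 in H.
  unfold cosh, sinh. lra.
Qed.

Lemma cosh_plus (x y : R) : cosh (x + y) = cosh x * cosh y + sinh x * sinh y.
Proof. unfold cosh, sinh. rewrite Ropp_plus_distr, !exp_plus. field. Qed.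

Lemma sinh_plus (x y : R) : sinh (x + y) = sinh x * cosh y + cosh x * sinh y.
Proof. unfold cosh, sinh. rewrite Ropp_plus_distr, !exp_plus. field. Qed.

Lemma radicand_eq (reg : region) (eps : R) (K : R -> R) (r : R) :
  radicand reg eps K r = K r * K r + region_sign reg * eps * (r * r).
Proof. destruct reg; simpl; ring. Qed.

Lemma pseudopolar_frame (reg : region) (sg rho nu : R) :
  pseudopolar reg sg rho nu = polar_frame reg (sg * rho) 0 nu.
Proof. destruct reg; simpl; f_equal; ring. Qed.

Lemma pseudopolar_boost (reg : region) (sg rho nu v : R) :
  boost v (pseudopolar reg sg rho nu) = pseudopolar reg sg rho (nu + v).
Proof.
  destruct reg; unfold boost; simpl; rewrite cosh_plus, sinh_plus; f_equal; ring.
Qed.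

(** The frame is orthonormal: the radial vector has square [region_sign reg] and the angular one the
    opposite square. Behind this is [cosh ^ 2 - sinh ^ 2 = 1]. *)
Lemma lorentz_frame (reg : region) (p q p' q' nu : R) :
  lorentz (polar_frame reg p q nu) (polar_frame reg p' q' nu)
  = region_sign reg * (p * p' - q * q').
Proof.
  assert (H := cosh_sqr nu).
  destruct reg; unfold lorentz; simpl;
    replace (p * p' - q * q') with
      ((p * p' - q * q') * (cosh nu * cosh nu - sinh nu * sinh nu)) by (rewrite H; ring);
    ring.
Qed.

Lemma pseudodist_pseudopolar (reg : region) (sg rho nu : R) :
  is_sign sg -> 0 < rho -> pseudodist (pseudopolar reg sg rho nu) = rho.
Proof.
  intros Hsg Hrho. unfold pseudodist. rewrite pseudopolar_frame, lorentz_frame.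
  replace (region_sign reg * (sg * rho * (sg * rho) - 0 * 0))
    with (region_sign reg * (sg * sg) * (rho * rho)) by ring.
  rewrite (is_sign_sqr sg Hsg), Rmult_1_r, Rabs_mult.
  replace (Rabs (region_sign reg)) with 1.
  - rewrite Rmult_1_l, (Rabs_pos_eq (rho * rho)) by nra. apply sqrt_square. lra.
  - destruct reg; simpl; unfold Rabs; destruct Rcase_abs; lra.
Qed.

(** Differentiating either frame vector with respect to [nu] gives the other one, without a minus
    sign. Hence the two cross terms. *)
Lemma is_derive_frame (reg : region) (p q nu : R -> R) (s dp dq dnu : R) :
  is_derive p s dp -> is_derive q s dq -> is_derive nu s dnu ->
  let v := polar_frame reg (dp + q s * dnu) (dq + p s * dnu) (nu s) in
  is_derive (fun t => fst (polar_frame reg (p t) (q t) (nu t))) s (fst v) /\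
  is_derive (fun t => snd (polar_frame reg (p t) (q t) (nu t))) s (snd v).
Proof.
  intros Hp Hq Hnu v.
  assert (Ep : Derive p s = dp) by now apply is_derive_unique.
  assert (Eq : Derive q s = dq) by now apply is_derive_unique.
  assert (En : Derive nu s = dnu) by now apply is_derive_unique.
  assert (Hex : ex_derive p s /\ ex_derive q s /\ ex_derive nu s).
  { repeat split; eexists; eassumption. }
  unfold v; destruct reg; simpl; unfold sinh, cosh; split; auto_derive;
    try tauto; change (fun x => p x) with p; change (fun x => q x) with q;
    change (fun x => nu x) with nu; rewrite ?Ep, ?Eq, ?En; field.
Qed.

(** Curve and tangent are known in frame form only on the parameter interval, so the derivative rule
    is needed under a local equality. *)
Lemma is_derive_near_frame (reg : region) (gamma : R -> R * R)
    (p q nu : R -> R) (s dp dq dnu : R) :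
  locally s (fun t => gamma t = polar_frame reg (p t) (q t) (nu t)) ->
  is_derive p s dp -> is_derive q s dq -> is_derive nu s dnu ->
  let v := polar_frame reg (dp + q s * dnu) (dq + p s * dnu) (nu s) in
  is_derive (fun t => fst (gamma t)) s (fst v) /\
  is_derive (fun t => snd (gamma t)) s (snd v).
Proof.
  intros Hg Hp Hq Hnu v.
  destruct (is_derive_frame reg p q nu s dp dq dnu Hp Hq Hnu) as [H1 H2].
  split; [apply is_derive_ext_loc with (2 := H1) | apply is_derive_ext_loc with (2 := H2)];
    apply filter_imp with (2 := Hg); intros t ->; reflexivity.
Qed.

Lemma pseudopolar_tangent (reg : region) (sg : R) (gamma : R -> R * R)
    (rho nu : R -> R) (s drho dnu : R) :
  locally s (fun t => gamma t = pseudopolar reg sg (rho t) (nu t)) ->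
  is_derive rho s drho -> is_derive nu s dnu ->
  ex_derive (fun t => fst (gamma t)) s /\ ex_derive (fun t => snd (gamma t)) s /\
  tangent gamma s = polar_frame reg (sg * drho) (sg * rho s * dnu) (nu s).
Proof.
  intros Hg Hrho Hnu.
  (* The position vector is purely radial, with components [sg * rho] and [0]. *)
  destruct (is_derive_near_frame reg gamma (fun t => sg * rho t) (fun _ => 0) nu
              s (sg * drho) 0 dnu) as [H1 H2]; try easy.
  - apply filter_imp with (2 := Hg). intros t ->. apply pseudopolar_frame.
  - now apply (is_derive_scal rho).
  - apply (is_derive_const (V := R_NormedModule)).
  - split; [eexists; exact H1|]. split; [eexists; exact H2|].
    replace (polar_frame _ _ _ _) with (polar_frame reg (sg * drho + 0 * dnu)
      (0 + sg * rho s * dnu) (nu s)) by (f_equal; ring).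
    apply injective_projections; now apply is_derive_unique.
Qed.

(** * From the first-order system for [rho] and [nu] to a solution curve *)

Lemma polar_ode_solution (reg : region) (sg eps o : R) (kappa K : R -> R)
    (a b sa sb : Rbar) (rho nu : R -> R) :
  Rbar_le (Finite 0) a ->
  (forall r, in_oo a b r -> is_derive K r (r * kappa r)) ->
  (forall r, in_oo a b r -> 0 < radicand reg eps K r) ->
  is_sign sg -> is_sign o ->
  (forall s, in_oo sa sb s ->
    in_oo a b (rho s) /\
    is_derive rho s (o * sqrt (radicand reg eps K (rho s)) / rho s) /\
    is_derive nu s (K (rho s) / rho s ^ 2)) ->
  solution reg sg eps kappa K a b sa sb
    (fun s => pseudopolar reg sg (rho s) (nu s)) nu.
Proof.
  intros Ha HK Hrad Hsg Ho H.
  set (gamma := fun s => pseudopolar reg sg (rho s) (nu s)).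
  assert (Hpos : forall s, in_oo sa sb s -> 0 < rho s).
  { intros s Hs. destruct (H s Hs) as [Hr _]. now apply (in_oo_pos a b). }
  assert (Hd : forall s, in_oo sa sb s -> pseudodist (gamma s) = rho s).
  { intros s Hs. now apply pseudodist_pseudopolar, Hpos. }
  (* [p] and [q] are the frame components [sg * rho'] and [sg * rho * nu'] of the tangent, with the
     system substituted. *)
  set (p := fun s => sg * (o * sqrt (radicand reg eps K (rho s)) / rho s)).
  set (q := fun s => sg * (K (rho s) / rho s)).
  assert (HT : forall s, in_oo sa sb s ->
    ex_derive (fun t => fst (gamma t)) s /\ ex_derive (fun t => snd (gamma t)) s /\
    tangent gamma s = polar_frame reg (p s) (q s) (nu s)).
  { intros s Hs. destruct (H s Hs) as [Hr [Hrho Hnu]]. specialize (Hpos s Hs).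
    destruct (fun Hloc => pseudopolar_tangent reg sg gamma rho nu s _ _ Hloc Hrho Hnu)
      as [E1 [E2 ET]]; [now apply filter_forall|].
    split; [exact E1|]. split; [exact E2|]. rewrite ET. unfold p, q. f_equal. field. lra. }
  intros s Hs. simpl. change (pseudopolar reg sg (rho s) (nu s)) with (gamma s).
  rewrite (Hd s Hs). destruct (H s Hs) as [Hr [Hrho Hnu]].
  assert (Hp := Hpos s Hs). destruct (HT s Hs) as [E1 [E2 ET]].
  assert (Hq := Hrad _ Hr). assert (Ho2 := is_sign_sqr o Ho).
  assert (Hsg2 := is_sign_sqr sg Hsg).
  set (Q := sqrt (radicand reg eps K (rho s))) in *.
  assert (HQ : 0 < Q) by now apply sqrt_lt_R0.
  assert (HQ2 : Q * Q = K (rho s) * K (rho s) + region_sign reg * eps * (rho s * rho s)).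
  { rewrite <- radicand_eq. apply sqrt_sqrt. lra. }
  split; [exact Hr|]. split; [reflexivity|]. split; [now eexists; exact Hnu|].
  split; [|split].
  - split; [exact E1|]. split; [exact E2|].
    rewrite ET, lorentz_frame. unfold p, q. fold Q.
    (* Up to the factor [region_sign reg], the square of the tangent is [(Q ^ 2 - K ^ 2) / rho ^ 2],
       and [Q ^ 2] is the radicand. *)
    replace (region_sign reg * _) with
      (region_sign reg * (sg * sg) * ((o * o) * (Q * Q) - K (rho s) * K (rho s)) / (rho s * rho s))
      by (field; lra).
    rewrite Hsg2, Ho2, HQ2.
    replace (region_sign reg * 1 * _ / _) with (region_sign reg * region_sign reg * eps)
      by (field; lra).
    rewrite (is_sign_sqr _ (is_sign_region reg)). ring.
  - set (k := fun t => K (rho t)).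
    set (dr := o * Q / rho s) in *.
    assert (Hk : is_derive k s (dr * (rho s * kappa (rho s)))).
    { apply (is_derive_comp K rho); [now apply HK | exact Hrho]. }
    assert (Er : Derive rho s = dr) by now apply is_derive_unique.
    assert (Ek : Derive k s = dr * (rho s * kappa (rho s))) by now apply is_derive_unique.
    assert (Hex : ex_derive rho s /\ ex_derive k s) by (split; eexists; eassumption).
    assert (EQ : sqrt (k s * k s + region_sign reg * eps * (rho s * rho s)) = Q).
    { unfold Q. now rewrite radicand_eq. }
    (* The normal swaps the coordinates of the tangent, hence its frame components. The Frenet
       equation therefore reads [p' + q nu' = kappa q] and [q' + p nu' = kappa p]. *)
    assert (Dp : is_derive p s (kappa (rho s) * q s - q s * (K (rho s) / rho s ^ 2))).
    { apply (is_derive_ext (fun t => sg *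
        (o * sqrt (k t * k t + region_sign reg * eps * (rho t * rho t)) / rho t))).
      - intros t. unfold p, k. now rewrite radicand_eq.
      - auto_derive.
        + repeat split; try tauto; try lra.
          unfold k. rewrite <- radicand_eq. exact Hq.
        + change (fun x => k x) with k. change (fun x => rho x) with rho.
          rewrite EQ, Er, Ek. unfold dr, q. fold (k s) in *.
          (* The relation [dK = rho kappa drho] yields the term with [kappa]. The rest reduces to
             [- K ^ 2 / rho ^ 3], because [Q ^ 2] is the radicand. *)
          transitivity (sg * ((o * o) * (kappa (rho s) * k s / rho s
                  + (region_sign reg * eps * (rho s * rho s) - Q * Q) / rho s ^ 3))).
          * field. lra.
          * rewrite Ho2, HQ2. field. lra. }
    assert (Dq : is_derive q s (kappa (rho s) * p s - p s * (K (rho s) / rho s ^ 2))).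
    { apply (is_derive_ext (fun t => sg * (k t / rho t))); [reflexivity|].
      auto_derive.
      - repeat split; try tauto; lra.
      - change (fun x => k x) with k. change (fun x => rho x) with rho.
        rewrite Er, Ek. unfold dr, p. fold Q (k s). field. lra. }
    destruct (fun Hloc => is_derive_near_frame reg (tangent gamma) p q nu s _ _ _
                            Hloc Dp Dq Hnu) as [F1 F2].
    { apply filter_imp with (2 := in_oo_locally sa sb s Hs). intros t Ht. now apply HT. }
    unfold curvature_at, normal. rewrite ET.
    replace (_ + q s * _) with (kappa (rho s) * q s) in F1, F2 by ring.
    replace (_ + p s * _) with (kappa (rho s) * p s) in F1, F2 by ring.
    split; [replace (_ * _) with (fst (polar_frame reg (kappa (rho s) * q s)
               (kappa (rho s) * p s) (nu s))); [exact F1|]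
           | replace (_ * _) with (snd (polar_frame reg (kappa (rho s) * q s)
               (kappa (rho s) * p s) (nu s))); [exact F2|]];
      destruct reg; simpl; ring.
  - unfold ang_momentum. rewrite (Hd s Hs), (is_derive_unique _ _ _ Hnu). field. lra.
Qed.

(** * From the quadratures, and from a solution, to the first-order system *)

Lemma is_derive_arc_param (reg : region) (eps o : R) (K : R -> R) (a b : Rbar)
    (r0 s0 r : R) :
  (forall t, in_oo a b t -> ex_derive K t) ->
  (forall t, in_oo a b t -> 0 < radicand reg eps K t) ->
  in_oo a b r0 -> in_oo a b r ->
  is_derive (arc_param reg eps o K r0 s0) r
    (o * (r / sqrt (radicand reg eps K r))).
Proof.
  intros HK Hrad Hr0 Hr. unfold arc_param.
  replace (o * (r / sqrt (radicand reg eps K r))) with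
    (plus 0 (o * (r / sqrt (radicand reg eps K r)))) by apply Rplus_0_l.
  apply (is_derive_plus (fun _ => s0)).
  - apply (is_derive_const (V := R_NormedModule)).
  - apply (is_derive_scal (RInt (fun t => t / sqrt (radicand reg eps K t)) r0)).
    apply (is_derive_RInt_oo a b (fun t => t / sqrt (radicand reg eps K t))); try easy.
    intros t Ht.
    apply (ex_derive_continuous (V := R_NormedModule)).
    apply ex_derive_ext with
      (fun u => u / sqrt (K u * K u + region_sign reg * eps * (u * u))).
    { intros u. now rewrite radicand_eq. }
    specialize (HK t Ht). specialize (Hrad t Ht). rewrite radicand_eq in Hrad.
    auto_derive. repeat split; try tauto.
    now apply Rgt_not_eq, sqrt_lt_R0.
Qed.

Lemma quadrature_ode (reg : region) (eps o : R) (K : R -> R) (a b : Rbar)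
    (r0 s0 nu0 : R) (sa sb : Rbar) (rho nu : R -> R) (s : R) :
  Rbar_le (Finite 0) a ->
  (forall r, in_oo a b r -> ex_derive K r) ->
  (forall r, in_oo a b r -> 0 < radicand reg eps K r) ->
  is_sign o -> in_oo a b r0 ->
  quadrature reg eps o K a b r0 s0 nu0 sa sb rho nu -> in_oo sa sb s ->
  in_oo a b (rho s) /\
  is_derive rho s (o * sqrt (radicand reg eps K (rho s)) / rho s) /\
  is_derive nu s (K (rho s) / rho s ^ 2).
Proof.
  intros Ha HK Hrad Ho Hr0 [Hinv Hnu].
  assert (Hpos : forall r, in_oo a b r -> 0 < r).
  { intros r. now apply in_oo_pos. }
  assert (HQ : forall r, in_oo a b r -> 0 < sqrt (radicand reg eps K r)).
  { intros r Hr. now apply sqrt_lt_R0, Hrad. }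
  assert (Ho2 := is_sign_sqr o Ho).
  (* [s0] is the value of the arc parameter at [r0], where the integral is zero. It can thus serve
     as base point of the integral for [nu]. *)
  assert (Hs0 : in_oo sa sb s0).
  { destruct (proj1 Hinv r0 Hr0) as [H _]. unfold arc_param in H.
    rewrite RInt_point in H. change (zero : R) with 0 in H.
    now replace s0 with (s0 + o * 0) by ring. }
  assert (Hrho : forall t, in_oo sa sb t ->
    is_derive rho t (o * sqrt (radicand reg eps K (rho t)) / rho t)).
  { intros t Ht. destruct (proj2 Hinv t Ht) as [Hr _].
    assert (H1 := Hpos _ Hr). assert (H2 := HQ _ Hr).
    (* The derivative of [rho] is the reciprocal of [ds / drho]; the sign [o] is its own inverse. *)
    replace (o * _ / _) with (/ (o * (rho t / sqrt (radicand reg eps K (rho t))))).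
    - apply (inverse_on_is_derive a b sa sb (arc_param reg eps o K r0 s0) rho
        (fun r => o * (r / sqrt (radicand reg eps K r))) o); try easy.
      + intros r Hr'. now apply (is_derive_arc_param reg eps o K a b).
      + intros r Hr'. rewrite <- Rmult_assoc, Ho2, Rmult_1_l.
        apply Rdiv_lt_0_compat; auto.
    - destruct Ho as [-> | ->]; field; lra. }
  intros Hs. split; [now apply Hinv|]. split; [now apply Hrho|].
  set (h := fun u => K (rho u) / rho u ^ 2).
  apply is_derive_ext_loc with (fun t => nu0 + RInt h s0 t).
  { apply filter_imp with (2 := in_oo_locally sa sb s Hs). intros t Ht.
    symmetry. now apply Hnu. }
  replace (K (rho s) / rho s ^ 2) with (plus 0 (h s)) by apply Rplus_0_l.
  apply (is_derive_plus (fun _ => nu0)).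
  - apply (is_derive_const (V := R_NormedModule)).
  - apply (is_derive_RInt_oo sa sb h); try easy. intros t Ht.
    destruct (proj2 Hinv t Ht) as [Hr _]. specialize (Hpos _ Hr).
    specialize (Hrho t Ht). specialize (HK _ Hr).
    assert (Er : ex_derive rho t) by (eexists; exact Hrho).
    apply (ex_derive_continuous (V := R_NormedModule)). unfold h.
    auto_derive. repeat split; try tauto. apply Rgt_not_eq. nra.
Qed.

(* [rho * rho'] is, up to sign, the inner product of [gamma] with its tangent,
   hence continuous; it has no zero because [(rho * rho')^2 = radicand]. *)
Lemma solution_ode (reg : region) (sg eps : R) (kappa K : R -> R)
    (a b ta tb : Rbar) (gamma : R -> R * R) (theta : R -> R) :
  Rbar_le (Finite 0) a ->
  (forall r, in_oo a b r -> 0 < radicand reg eps K r) -> is_sign sg ->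
  solution reg sg eps kappa K a b ta tb gamma theta ->
  let rho := fun t => pseudodist (gamma t) in
  exists o, is_sign o /\ forall s, in_oo ta tb s ->
    is_derive rho s (o * sqrt (radicand reg eps K (rho s)) / rho s) /\
    is_derive theta s (K (rho s) / rho s ^ 2).
Proof.
  intros Ha Hrad Hsg Hsol rho. set (sigma := region_sign reg).
  assert (Hsg2 := is_sign_sqr sg Hsg).
  assert (Hsigma : is_sign sigma) by apply is_sign_region.
  assert (Hsigma2 := is_sign_sqr sigma Hsigma).
  assert (Hpos : forall s, in_oo ta tb s -> 0 < rho s).
  { intros s Hs. apply (in_oo_pos a b); [exact Ha | apply (Hsol s Hs)]. }
  assert (Hloc : forall s, in_oo ta tb s ->
    locally s (fun t => gamma t = pseudopolar reg sg (rho t) (theta t))).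
  { intros s Hs. apply filter_imp with (2 := in_oo_locally ta tb s Hs).
    intros t Ht. apply (Hsol t Ht). }
  assert (Hsq : forall s, in_oo ta tb s ->
    sigma * lorentz (gamma s) (gamma s) = rho s * rho s).
  { intros s Hs. destruct (Hsol s Hs) as [_ [-> _]]. fold (rho s).
    rewrite pseudopolar_frame, lorentz_frame. fold sigma.
    transitivity ((sigma * sigma) * (sg * sg) * (rho s * rho s)); [ring|].
    rewrite Hsigma2, Hsg2. ring. }
  assert (Htheta : forall s, in_oo ta tb s -> is_derive theta s (K (rho s) / rho s ^ 2)).
  { intros s Hs. specialize (Hpos s Hs).
    destruct (Hsol s Hs) as [_ [_ [Ex [_ [_ E]]]]].
    unfold ang_momentum in E. fold (rho s) in E. rewrite <- E.
    replace (_ / _) with (Derive theta s) by (field; lra). now apply Derive_correct. }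
  assert (Hrho : forall s, in_oo ta tb s -> ex_derive rho s).
  { intros s Hs.
    set (x := fun t => fst (gamma t)). set (y := fun t => snd (gamma t)).
    (* Differentiability of [rho] is recovered from that of the coordinates: [rho] is the root of
       [sigma * lorentz gamma gamma], which is positive here, so the root is smooth. *)
    apply ex_derive_ext_loc with (fun t => sqrt (sigma * (- (x t * x t) + y t * y t))).
    - apply filter_imp with (2 := in_oo_locally ta tb s Hs). intros t Ht.
      transitivity (sqrt (rho t * rho t)).
      + now rewrite <- Hsq.
      + apply sqrt_square. specialize (Hpos t Ht). lra.
    - assert (H0 : 0 < sigma * (- (x s * x s) + y s * y s)).
      { change (0 < sigma * lorentz (gamma s) (gamma s)). rewrite (Hsq s Hs).
        specialize (Hpos s Hs). nra. }
      destruct (Hsol s Hs) as [_ [_ [_ [[Ex [Ey _]] _]]]].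
      fold x in Ex. fold y in Ey. auto_derive. tauto. }
  assert (HT : forall s, in_oo ta tb s ->
    tangent gamma s = polar_frame reg (sg * Derive rho s)
                        (sg * rho s * (K (rho s) / rho s ^ 2)) (theta s)).
  { intros s Hs. apply pseudopolar_tangent; [now apply Hloc | | now apply Htheta].
    now apply Derive_correct, Hrho. }
  assert (HD : forall s, in_oo ta tb s ->
    sigma * lorentz (gamma s) (tangent gamma s) = rho s * Derive rho s).
  { intros s Hs. rewrite (HT s Hs). destruct (Hsol s Hs) as [_ [E _]].
    fold (rho s) in E. rewrite E, pseudopolar_frame, lorentz_frame. fold sigma.
    transitivity ((sigma * sigma) * (sg * sg) * (rho s * Derive rho s)); [ring|].
    rewrite Hsigma2, Hsg2. ring. }
  assert (Hunit : forall s, in_oo ta tb s ->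
    (rho s * Derive rho s) * (rho s * Derive rho s) = radicand reg eps K (rho s)).
  { intros s Hs. specialize (Hpos s Hs).
    destruct (Hsol s Hs) as [_ [_ [_ [[_ [_ E]] _]]]].
    rewrite (HT s Hs), lorentz_frame in E. fold sigma in E.
    rewrite radicand_eq. fold sigma. rewrite <- E.
    transitivity (K (rho s) * K (rho s) + (sigma * sigma) * (sg * sg) *
      (rho s * rho s * Derive rho s * Derive rho s - K (rho s) * K (rho s))).
    - rewrite Hsigma2, Hsg2. ring.
    - field. lra. }
  (* Continuity of this product uses the Frenet equation, which makes the tangent differentiable. *)
  destruct (constant_sign ta tb (fun s => sigma * lorentz (gamma s) (tangent gamma s)))
    as [o [Ho Hsign]].
  - intros s Hs. apply (ex_derive_continuous (V := R_NormedModule)).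
    destruct (Hsol s Hs) as [_ [_ [_ [[Ex [Ey _]] [[Hu Hv] _]]]]].
    unfold lorentz.
    set (x := fun t => fst (gamma t)) in *. set (y := fun t => snd (gamma t)) in *.
    set (u := fun t => fst (tangent gamma t)) in *.
    set (v := fun t => snd (tangent gamma t)) in *.
    assert (Eu : ex_derive u s) by (eexists; exact Hu).
    assert (Ev : ex_derive v s) by (eexists; exact Hv).
    change (ex_derive (fun t => sigma * (- (x t * u t) + y t * v t)) s).
    auto_derive. tauto.
  - intros s Hs. rewrite (HD s Hs). intros E.
    assert (H := Hunit s Hs). rewrite E in H.
    assert (H' := Hrad _ (proj1 (Hsol s Hs))). fold (rho s) in H'. lra.
  - exists o. split; [exact Ho|]. intros s Hs. split; [|now apply Htheta].
    specialize (Hsign s Hs). simpl in Hsign. rewrite (HD s Hs) in Hsign.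
    rewrite <- (Hunit s Hs). specialize (Hpos s Hs).
    (* The positive root of the radicand is [o * (rho * rho')], by the choice of [o]. *)
    replace (rho s * Derive rho s * (rho s * Derive rho s)) with
      ((o * (rho s * Derive rho s)) * (o * (rho s * Derive rho s))).
    + rewrite sqrt_square by lra.
      replace (o * _ / _) with ((o * o) * Derive rho s) by (field; lra).
      rewrite (is_sign_sqr o Ho), Rmult_1_l. now apply Derive_correct, Hrho.
    + transitivity ((o * o) * (rho s * Derive rho s * (rho s * Derive rho s))); [ring|].
      rewrite (is_sign_sqr o Ho). ring.
Qed.

(** * Existence by quadratures, and uniqueness up to boost and translation *)

Theorem theorem2p1 (a b : Rbar) (kappa K : R -> R) (reg : region) (sg eps : R)
    (ha : Rbar_le (Finite 0) a)
    (hkappa : forall r, in_oo a b r -> continuous (fun t => t * kappa t) r)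
    (hK : forall r, in_oo a b r -> is_derive K r (r * kappa r))
    (hsg : is_sign sg) (heps : is_sign eps)
    (hrad : forall r, in_oo a b r -> 0 < radicand reg eps K r) :
  (* the quadratures can be carried out, and the resulting curve is a solution *)
  (forall o r0 s0 nu0 : R, is_sign o -> in_oo a b r0 ->
    (exists (sa sb : Rbar) (rho nu : R -> R),
      quadrature reg eps o K a b r0 s0 nu0 sa sb rho nu) /\
    (forall (sa sb : Rbar) (rho nu : R -> R),
      quadrature reg eps o K a b r0 s0 nu0 sa sb rho nu ->
      solution reg sg eps kappa K a b sa sb
        (fun s => pseudopolar reg sg (rho s) (nu s)) nu)) /\
  (* every solution is obtained in this way, up to an orthochrone Lorentz
     transformation and a translation of the arc parameter *)
  (forall (ta tb : Rbar) (gamma : R -> R * R) (theta : R -> R),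
    solution reg sg eps kappa K a b ta tb gamma theta ->
    exists o : R, is_sign o /\
      (forall s, in_oo ta tb s ->
        ex_derive (fun t => pseudodist (gamma t)) s /\
        0 < o * Derive (fun t => pseudodist (gamma t)) s) /\
      forall (r0 s0 nu0 : R) (sa sb : Rbar) (rho nu : R -> R),
        in_oo a b r0 ->
        quadrature reg eps o K a b r0 s0 nu0 sa sb rho nu ->
        exists v c : R, forall s, in_oo ta tb s ->
          in_oo sa sb (s + c) /\
          gamma s =
            boost v (pseudopolar reg sg (rho (s + c)) (nu (s + c)))).
Proof.
  assert (HK : forall r, in_oo a b r -> ex_derive K r).
  { intros r Hr. eexists. now apply hK. }
  assert (Hpos : forall r, in_oo a b r -> 0 < r).
  { intros r. now apply in_oo_pos. }
  assert (HQ : forall r, in_oo a b r -> 0 < sqrt (radicand reg eps K r)).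
  { intros r Hr. now apply sqrt_lt_R0, hrad. }
  split.
  - intros o r0 s0 nu0 Ho Hr0. split.
    + destruct (inverse_on_exists a b (arc_param reg eps o K r0 s0)
        (fun r => o * (r / sqrt (radicand reg eps K r))) o) as [sa [sb [rho Hrho]]].
      * intros r Hr. now apply (is_derive_arc_param reg eps o K a b).
      * exact Ho.
      * intros r Hr. rewrite <- Rmult_assoc, (is_sign_sqr o Ho), Rmult_1_l.
        apply Rdiv_lt_0_compat; auto.
      * exists sa, sb, rho, (angle K rho s0 nu0). now split.
    + intros sa sb rho nu Hquad.
      apply (polar_ode_solution reg sg eps o); try easy.
      intros s. now apply (quadrature_ode reg eps o K a b r0 s0 nu0 sa sb).
  - intros ta tb gamma theta Hsol.
    assert (Hode := solution_ode reg sg eps kappa K a b ta tb gamma theta ha hrad hsg Hsol).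
    set (varrho := fun t => pseudodist (gamma t)) in *. destruct Hode as [o [Ho Hode]].
    assert (Ho2 := is_sign_sqr o Ho).
    assert (Hr : forall s, in_oo ta tb s -> in_oo a b (varrho s)).
    { intros s Hs. apply (Hsol s Hs). }
    exists o. split; [exact Ho|]. split.
    + intros s Hs. destruct (Hode s Hs) as [Hd _].
      split; [eexists; exact Hd|]. rewrite (is_derive_unique _ _ _ Hd).
      apply Rlt_le_trans with ((o * o) * (sqrt (radicand reg eps K (varrho s)) / varrho s)).
      * rewrite Ho2, Rmult_1_l. apply Rdiv_lt_0_compat; auto.
      * right. unfold Rdiv. ring.
    + intros r0 s0 nu0 sa sb rho nu Hr0 Hquad.
      destruct (classic (exists t0, in_oo ta tb t0)) as [[t0 Ht0] | Hn].
      (* On an empty parameter interval there is no reference point [t0], and any witnesses do. *)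
      2: { exists 0, 0. intros s Hs. elim Hn. now exists s. }
      set (A := arc_param reg eps o K r0 s0).
      (* [A] composed with [varrho] has derivative [o * o = 1], so it is a translation; its amount
         is read off at [t0]. *)
      set (c := A (varrho t0) - t0).
      assert (Hc : forall s, in_oo ta tb s -> A (varrho s) = s + c).
      { intros s Hs. cut (A (varrho s) - s = A (varrho t0) - t0).
        { unfold c. lra. }
        apply (is_derive_zero_const ta tb (fun t => A (varrho t) - t)); try easy.
        intros t Ht. destruct (Hode t Ht) as [Hd _].
        assert (HA := is_derive_arc_param reg eps o K a b r0 s0 _ HK hrad Hr0 (Hr t Ht)).
        assert (HAr := is_derive_comp A varrho t _ _ HA Hd).
        replace 0 with (minus (scal (o * sqrt (radicand reg eps K (varrho t)) / varrho t)
          (o * (varrho t / sqrt (radicand reg eps K (varrho t))))) 1).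
        - apply (is_derive_minus (fun u => A (varrho u)) (fun u => u)); [exact HAr|].
          apply (is_derive_id (K := R_AbsRing)).
        - unfold minus, plus, opp, scal; simpl; unfold mult; simpl.
          assert (H1 := Hpos _ (Hr t Ht)). assert (H2 := HQ _ (Hr t Ht)).
          transitivity (o * o - 1); [field; lra | rewrite Ho2; ring]. }
      (* The quadrature [rho] inverts [A], so applying it to [A (varrho s) = s + c] recovers
         [varrho s]. *)
      assert (Hshift : forall s, in_oo ta tb s ->
        in_oo sa sb (s + c) /\ rho (s + c) = varrho s).
      { intros s Hs. rewrite <- (Hc s Hs). now apply Hquad, Hr. }
      (* After the shift both angles have derivative [K / varrho ^ 2]. Their constant difference is
         the boost angle, since a boost by [v] adds [v] to the pseudopolar angle. *)
      set (v := theta t0 - nu (t0 + c)).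
      assert (Hv : forall s, in_oo ta tb s -> theta s = nu (s + c) + v).
      { intros s Hs. cut (theta s - nu (s + c) = theta t0 - nu (t0 + c)).
        { unfold v. lra. }
        apply (is_derive_zero_const ta tb (fun t => theta t - nu (t + c))); try easy.
        intros t Ht. destruct (Hode t Ht) as [_ Hd].
        destruct (Hshift t Ht) as [Htc Erho].
        destruct (quadrature_ode reg eps o K a b r0 s0 nu0 sa sb rho nu (t + c))
          as [_ [_ Hnu]]; try easy.
        rewrite Erho in Hnu.
        assert (Et : Derive theta t = K (varrho t) / varrho t ^ 2)
          by now apply is_derive_unique.
        assert (En : Derive nu (t + c) = K (varrho t) / varrho t ^ 2)
          by now apply is_derive_unique.
        auto_derive.
        - split; [eexists; exact Hd|]. split; [eexists; exact Hnu | easy].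
        - change (fun x => theta x) with theta. change (fun x => nu x) with nu.
          rewrite Et, En. ring. }
      exists v, c. intros s Hs. destruct (Hshift s Hs) as [Hsc Erho].
      split; [exact Hsc|]. rewrite Erho, pseudopolar_boost, <- (Hv s Hs).
      apply (Hsol s Hs).
Qed.
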